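(* Let $q$ be a nonzero complex number with $|q|<1$, and let $a,b$ be complex numbers with $a+b\neq 0$ and $\left|\frac{b}{a+b}\right|<1$. For each integer $n\ge 0$ put $$p(n)=\big(b q^{a+n}+a q^{a+n}-a q^{a}-b q^{n}\big)\big(b q^{a+n+1}+a q^{a+n+1}-a q^{a}-b q^{n+1}\big).$$ Assume that all denominators occurring below are nonzero, i.e. $b\ne 0$, $q^a\neq 1$, $a q^a-b(1-q^a)\neq 0$, and $p(n)\neq 0$ for all $n\ge 0$. Then $$(a+b)(1-q)^2 q^{2a-1}\sum_{n=0}^{\infty}\frac{\left(\frac{bq}{a+b}\right)^n}{p(n)}\,\frac{(q^{1-a};q)_n}{(q;q)_n} =\frac{(a+b)(1-q)q^{2a-1}}{b\left(1-q^a\right)\left(a q^a-b\left(1-q^a\right)\right)}-\frac{1}{q\left(a+b-bq^{-a}\right)}\;{}_2\phi_1\!\left[\begin{matrix}q^{1-a},\,q\\ q^{2}\end{matrix};q,\frac{b}{a+b}\right].$$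
   Context: For $|q|<1$ and complex $x$, the $q$-shifted factorial is $(x;q)_0=1$ and $(x;q)_n=\prod_{k=0}^{n-1}(1-xq^k)$ for $n\ge 1$. The basic hypergeometric series is $${}_2\phi_1\!\left[\begin{matrix}a_1,a_2\\ b_1\end{matrix};q,x\right]=\sum_{n=0}^{\infty}\frac{(a_1;q)_n(a_2;q)_n}{(q;q)_n(b_1;q)_n}x^n .$$ Powers $q^{s}$ with complex exponent $s$ mean $\exp(s\log q)$ for a fixed choice of $\log q$ (the real logarithm when $0<q<1$). *)

(* Defs.v *)
From Stdlib Require Export Reals.
From Coquelicot Require Export Coquelicot.

Open Scope C_scope.

Definition Cexp (z : C) : C :=
  RtoC (exp (Re z)) * (cos (Im z), sin (Im z)).

(* The power q^s with complex exponent s, where L is the chosen value of log q,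
   i.e. Cexp L = q. *)
Definition qpow (L s : C) : C := Cexp (s * L).

(* (x; q)_n *)
Fixpoint qpoch (x q : C) (n : nat) : C :=
  match n with
  | O => 1
  | S m => qpoch x q m * (1 - x * q ^ m)
  end.

Definition ex_Cseries (u : nat -> C) : Prop :=
  @ex_series C_AbsRing C_NormedModule u.

(* Total: only meaningful for u such that [ex_Cseries u], see
   [is_series_CSeries]. *)
Definition CSeries (u : nat -> C) : C :=
  (Series (fun n => Re (u n)), Series (fun n => Im (u n))).

Definition phi21_term (a1 a2 b1 q x : C) (n : nat) : C :=
  qpoch a1 q n * qpoch a2 q n / (qpoch q q n * qpoch b1 q n) * x ^ n.

Definition phi21 (a1 a2 b1 q x : C) : C := CSeries (phi21_term a1 a2 b1 q x).

(* The integer powers q^n, q^(n+1) do not depend on the choice of L. *)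
Definition p_den (L q a b : C) (n : nat) : C :=
  let N := RtoC (INR n) in
  (b * qpow L (a + N) + a * qpow L (a + N) - a * qpow L a - b * q ^ n) *
  (b * qpow L (a + N + 1) + a * qpow L (a + N + 1) - a * qpow L a
     - b * q ^ (n + 1)).

Lemma is_series_CSeries (u : nat -> C) (l : C) :
  @is_series C_AbsRing C_NormedModule u l -> CSeries u = l.
Proof.
intros H.
assert (Hre : forall n, Re (@sum_n C_AbsRing u n)
                = sum_n (fun k => Re (u k)) n).
{ induction n as [|n IH]; [now rewrite !sum_O|].
  now rewrite !sum_Sn, <- IH. }
assert (Him : forall n, Im (@sum_n C_AbsRing u n)
                = sum_n (fun k => Im (u k)) n).
{ induction n as [|n IH]; [now rewrite !sum_O|].
  now rewrite !sum_Sn, <- IH. }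
destruct l as [x y]; unfold CSeries; f_equal; apply is_series_unique;
  apply filterlim_locally; intros eps;
  destruct (proj1 (filterlim_locally _ _) H eps) as [N HN];
  exists N; intros n Hn; specialize (HN n Hn).
- rewrite <- Hre. exact (proj1 HN).
- rewrite <- Him. exact (proj2 HN).
Qed.

(* Main.v *)
Require Import Defs.
From Stdlib Require Import Lra Lia.
Open Scope C_scope.

(** Write [A = q^a], [x = b / (a + b)] and [t_n = (q/A; q)_n / (q; q)_n].
    The denominator factors as [p(n) = g_n g_(n+1)] with
    [g_n = - a A + ((a + b) A - b) q^n] ([pfac]), and since
    [g_n - g_(n+1) = (1 - q) ((a + b) A - b) q^n], the summand
    [(x q)^n t_n / p(n)] is a constant multiple of
    [x^n t_n (1/g_(n+1) - 1/g_n)].  Summation by parts moves the difference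
    onto [x^n t_n].  The value of [x] is exactly the one for which
    [x t_(n+1) - t_n] contains the factor [g_(n+1)], so that the denominator
    cancels and the remaining series has the terms [x^n t_n / (1 - q^(n+1))];
    up to the factor [1 - q] this is the 2-phi-1 series with parameters [q/A],
    [q] over [q^2] ([summand_by_parts], [phi21_term_q_q2]).

    The first term on the right of the theorem is the boundary value
    [- 1/g_0 = 1 / (b (1 - A))].  At infinity [x^n t_n / g_n] vanishes
    ([is_lim_seq_Cmod_qbin_pfac]): the 2-phi-1 series converges by the ratio
    test ([ex_series_Cmod_phi21_q_q2]), and [g_n] tends to [- a A], which is
    nonzero because [a = 0] would give [x = 1].  The convergence of both series
    in the theorem comes out of the same argument. *)

(** * Complex powers of q *)

Lemma Cexp_plus (z w : C) : Cexp (z + w) = Cexp z * Cexp w.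
Proof.
destruct z as [x y], w as [x' y']; unfold Cexp; simpl.
rewrite exp_plus, cos_plus, sin_plus.
apply injective_projections; simpl; ring.
Qed.

Lemma Cexp_0 : Cexp 0 = 1.
Proof.
unfold Cexp; simpl; rewrite exp_0, cos_0, sin_0.
apply injective_projections; simpl; ring.
Qed.

Lemma qpow_add (L s t : C) : qpow L (s + t) = qpow L s * qpow L t.
Proof. unfold qpow; rewrite <- Cexp_plus; f_equal; ring. Qed.

Lemma qpow_0 (L : C) : qpow L 0 = 1.
Proof. unfold qpow; rewrite Cmult_0_l; exact Cexp_0. Qed.

Lemma qpow_1 (L : C) : qpow L 1 = Cexp L.
Proof. unfold qpow; f_equal; ring. Qed.

Lemma qpow_neq_0 (L s : C) : qpow L s <> 0.
Proof.
intros H; apply C1_nz.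
rewrite <- (qpow_0 L); replace (RtoC 0) with (s + - s) at 1 by ring.
rewrite qpow_add, H; ring.
Qed.

Lemma qpow_opp (L s : C) : qpow L (- s) = / qpow L s.
Proof.
pose proof (qpow_neq_0 L s) as Hs.
assert (H : qpow L (- s) * qpow L s = 1).
{ rewrite <- qpow_add, <- (qpow_0 L); f_equal; ring. }
replace (qpow L (- s)) with (qpow L (- s) * qpow L s * / qpow L s)
  by (field; exact Hs).
rewrite H; ring.
Qed.

Lemma qpow_INR (L : C) (n : nat) : qpow L (RtoC (INR n)) = Cexp L ^ n.
Proof.
induction n as [|n IH]; [exact (qpow_0 L)|].
rewrite S_INR, RtoC_plus, qpow_add, IH, qpow_1, Cpow_S; ring.
Qed.

(** * Complex sequences and series *)

(** The triangle inequality squeezes the modulus between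
    [|w| - |c| |z|^n] and [|w| + |c| |z|^n]. *)
Lemma is_lim_seq_Cmod_add_geom (w c z : C) :
  (Cmod z < 1)%R -> is_lim_seq (fun n => Cmod (w + c * z ^ n)) (Cmod w).
Proof.
intros Hz.
assert (Hg : is_lim_seq (fun n => (Cmod c * Cmod z ^ n)%R) 0).
{ replace (Finite 0) with (Rbar_mult (Cmod c) 0)
    by (simpl; now rewrite Rmult_0_r).
  apply is_lim_seq_scal_l, is_lim_seq_geom.
  rewrite Rabs_pos_eq; [exact Hz | apply Cmod_ge_0]. }
apply is_lim_seq_le_le with
  (u := fun n => (Cmod w - Cmod c * Cmod z ^ n)%R)
  (w := fun n => (Cmod w + Cmod c * Cmod z ^ n)%R).
- intros n; rewrite <- Cmod_pow, <- Cmod_mult; split.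
  + pose proof (Cmod_triangle (w + c * z ^ n) (- (c * z ^ n))) as H.
    rewrite Cmod_opp in H.
    replace (w + c * z ^ n + - (c * z ^ n)) with w in H by ring.
    lra.
  + apply Cmod_triangle.
- replace (Finite (Cmod w)) with (Finite (Cmod w - 0)) by (f_equal; lra).
  apply is_lim_seq_minus'; [apply is_lim_seq_const | exact Hg].
- replace (Finite (Cmod w)) with (Finite (Cmod w + 0)) by (f_equal; lra).
  apply is_lim_seq_plus'; [apply is_lim_seq_const | exact Hg].
Qed.

(** The ratio test, with the ratios [c n] given as a multiplier rather than as
    quotients so that terms of the series may vanish. *)
Lemma ex_series_Cmod_ratio (f c : nat -> C) (l : R) :
  (forall n, f (S n) = c n * f n) ->
  is_lim_seq (fun n => Cmod (c n)) l -> (l < 1)%R ->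
  ex_series (fun n => Cmod (f n)).
Proof.
intros Hf Hc Hl.
assert (Hl0 : (0 <= l)%R).
{ apply (is_lim_seq_le (fun _ => 0%R) (fun n => Cmod (c n)) 0 l);
    [intros n; apply Cmod_ge_0 | apply is_lim_seq_const | exact Hc]. }
assert (He : (0 < (1 - l) / 2)%R) by lra.
destruct (proj2 (is_lim_seq_spec _ _) Hc (mkposreal _ He)) as [N HN].
simpl in HN; set (r := ((1 + l) / 2)%R).
apply (ex_series_incr_n _ N).
apply (@ex_series_le R_AbsRing R_CompleteNormedModule) with
  (b := fun k => (Cmod (f N) * r ^ k)%R).
- intros k; change (norm (Cmod (f (N + k)%nat)))
    with (Rabs (Cmod (f (N + k)%nat))).
  rewrite Rabs_pos_eq by apply Cmod_ge_0.
  induction k as [|k IH]; [rewrite Nat.add_0_r; simpl; lra|].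
  rewrite Nat.add_succ_r, Hf, Cmod_mult.
  replace (Cmod (f N) * r ^ S k)%R with (r * (Cmod (f N) * r ^ k))%R
    by (simpl; ring).
  apply Rmult_le_compat; try apply Cmod_ge_0; [|exact IH].
  specialize (HN (N + k)%nat ltac:(lia)).
  apply Rabs_def2 in HN; unfold r; lra.
- apply (@ex_series_scal R_AbsRing R_NormedModule (Cmod (f N))).
  apply ex_series_geom; unfold r; rewrite Rabs_pos_eq; lra.
Qed.

Lemma ex_Cseries_Cmod (f : nat -> C) :
  ex_series (fun n => Cmod (f n)) -> ex_Cseries f.
Proof.
intros H.
apply (@ex_series_le C_AbsRing C_CompleteNormedModule f
         (fun n => Cmod (f n))); [|exact H].
intros n; apply Rle_refl.
Qed.

(** The partial sums are [v (S n) - v O]. *)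
Lemma is_series_telescope (v : nat -> C) :
  is_lim_seq (fun n => Cmod (v n)) 0 ->
  @is_series C_AbsRing C_NormedModule (fun n => v (S n) - v n) (- v O).
Proof.
intros Hv.
assert (Hsum : forall n,
  @sum_n C_AbsRing (fun n => v (S n) - v n) n = v (S n) - v O).
{ induction n as [|n IH]; [now rewrite sum_O|].
  rewrite sum_Sn, IH.
  change (v (S n) - v O + (v (S (S n)) - v (S n)) = v (S (S n)) - v O).
  ring. }
apply filterlim_locally; intros eps.
apply is_lim_seq_incr_1 in Hv.
destruct (proj2 (is_lim_seq_spec _ _) Hv eps) as [N HN].
exists N; intros n Hn.
apply C_NormedModule_mixin_compat1.
change (Rlt (Cmod (@sum_n C_AbsRing (fun n => v (S n) - v n) n - - v O)) eps).
rewrite Hsum; replace (v (S n) - v O - - v O) with (v (S n)) by ring.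
specialize (HN n Hn); simpl in HN.
rewrite Rminus_0_r, Rabs_pos_eq in HN; [exact HN | apply Cmod_ge_0].
Qed.

(** * The q-shifted factorials *)

Lemma one_sub_pow_neq_0 (q : C) (hq1 : (Cmod q < 1)%R) (n : nat) : 1 - q ^ S n <> 0.
Proof.
intros H.
assert (Hq : q ^ S n = 1).
{ replace (q ^ S n) with (1 - (1 - q ^ S n)) by ring; rewrite H; ring. }
apply (f_equal Cmod) in Hq; rewrite Cmod_pow, Cmod_1 in Hq.
pose proof (pow_lt_1_compat (Cmod q) (S n)) as Hlt.
pose proof (Cmod_ge_0 q); specialize (Hlt ltac:(lra) ltac:(lia)); lra.
Qed.

Lemma qpoch_q_neq_0 (q : C) (hq1 : (Cmod q < 1)%R) (n : nat) : qpoch q q n <> 0.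
Proof.
induction n as [|n IH]; [exact C1_nz|].
apply Cmult_neq_0; [exact IH|].
rewrite <- Cpow_S; apply (one_sub_pow_neq_0 q hq1 _).
Qed.

Lemma qpoch_q2 (q : C) (n : nat) :
  (1 - q) * qpoch (q ^ 2) q n = qpoch q q n * (1 - q ^ S n).
Proof.
induction n as [|n IH]; [simpl; ring|].
change ((1 - q) * (qpoch (q ^ 2) q n * (1 - q ^ 2 * q ^ n)) =
  qpoch q q n * (1 - q * q ^ n) * (1 - q ^ S (S n))).
rewrite Cmult_assoc, IH, !Cpow_S; ring.
Qed.

Lemma one_sub_q_neq_0 (q : C) (hq1 : (Cmod q < 1)%R) : 1 - q <> 0.
Proof. rewrite <- (Cpow_1_r q); apply (one_sub_pow_neq_0 q hq1 _). Qed.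

Lemma qpoch_q2_neq_0 (q : C) (hq1 : (Cmod q < 1)%R) (n : nat) : qpoch (q ^ 2) q n <> 0.
Proof.
intros H; pose proof (qpoch_q2 q n) as E; rewrite H, Cmult_0_r in E.
symmetry in E; revert E; apply Cmult_neq_0;
  [apply (qpoch_q_neq_0 q hq1) | apply (one_sub_pow_neq_0 q hq1 _)].
Qed.

(** The lower parameter [q^2] only contributes the factor
    [(q;q)_n / (q^2;q)_n = (1 - q) / (1 - q^(n+1))]. *)
Lemma phi21_term_q_q2 (q : C) (hq1 : (Cmod q < 1)%R) (al x : C) (n : nat) :
  phi21_term al q (q ^ 2) q x n =
  x ^ n * (qpoch al q n / qpoch q q n) * (1 - q) / (1 - q ^ S n).
Proof.
pose proof (qpoch_q_neq_0 q hq1 n); pose proof (qpoch_q2_neq_0 q hq1 n).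
pose proof (one_sub_pow_neq_0 q hq1 n); pose proof (one_sub_q_neq_0 q hq1).
assert (E : qpoch (q ^ 2) q n = qpoch q q n * (1 - q ^ S n) / (1 - q)).
{ rewrite <- qpoch_q2; field; assumption. }
unfold phi21_term; rewrite E; field; auto.
Qed.

Lemma phi21_term_q_q2_S (q : C) (hq1 : (Cmod q < 1)%R) (al x : C) (n : nat) :
  phi21_term al q (q ^ 2) q x (S n) =
  x * (1 - al * q ^ n) / (1 - q ^ S (S n)) * phi21_term al q (q ^ 2) q x n.
Proof.
pose proof (qpoch_q_neq_0 q hq1 n); pose proof (one_sub_pow_neq_0 q hq1 n).
pose proof (one_sub_pow_neq_0 q hq1 (S n)).
rewrite !(phi21_term_q_q2 q hq1).
change (qpoch al q (S n)) with (qpoch al q n * (1 - al * q ^ n)).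
change (qpoch q q (S n)) with (qpoch q q n * (1 - q ^ S n)).
rewrite (Cpow_S x); field; auto.
Qed.


Lemma ex_series_Cmod_phi21_q_q2 (q : C) (hq1 : (Cmod q < 1)%R) (al x : C) :
  (Cmod x < 1)%R ->
  ex_series (fun n => Cmod (phi21_term al q (q ^ 2) q x n)).
Proof.
intros Hx.
apply (ex_series_Cmod_ratio _ _ (Cmod x)
         (phi21_term_q_q2_S q hq1 al x)); [|exact Hx].
apply is_lim_seq_ext with (u := fun n =>
  (Cmod x * Cmod (1 + - al * q ^ n) / Cmod (1 + - q ^ 2 * q ^ n))%R).
{ intros n; pose proof (one_sub_pow_neq_0 q hq1 (S n)).
  rewrite Cmod_div, Cmod_mult by assumption.
  replace (1 - q ^ S (S n)) with (1 + - q ^ 2 * q ^ n)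
    by (rewrite !Cpow_S; ring).
  replace (1 - al * q ^ n) with (1 + - al * q ^ n) by ring.
  reflexivity. }
replace (Finite (Cmod x)) with (Finite (Cmod x * Cmod 1 / Cmod 1))
  by (rewrite Cmod_1; f_equal; field).
apply is_lim_seq_div'.
- apply is_lim_seq_mult'; [apply is_lim_seq_const|].
  now apply is_lim_seq_Cmod_add_geom.
- now apply is_lim_seq_Cmod_add_geom.
- rewrite Cmod_1; lra.
Qed.

(** * Summation by parts *)

(** The common shape of the two factors of [p(n)], with [A] for [q^a]. *)
Definition pfac (A a b q : C) (n : nat) : C :=
  - (a * A) + ((a + b) * A - b) * q ^ n.

Definition qbin_term (A x q : C) (n : nat) : C :=
  x ^ n * (qpoch (q / A) q n / qpoch q q n).

(** Two identities are combined here: [pfac n - pfac (n+1)] is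
    [(1 - q) ((a + b) A - b) q^n], which splits [q^n / p(n)] into a difference
    of reciprocals; and [x t_(n+1) - t_n], for the coefficients
    [t_n] of [qbin_term], is [t_n pfac (n+1) / ((a + b) A (1 - q^(n+1)))]
    because [x = b / (a + b)]. *)
Lemma summand_by_parts (A a b q : C) (hq1 : (Cmod q < 1)%R)
    (hA : A <> 0) (hab : a + b <> 0) (hD : (a + b) * A - b <> 0) (n : nat)
    (hn : pfac A a b q n <> 0) (hSn : pfac A a b q (S n) <> 0) :
  (b * q / (a + b)) ^ n / (pfac A a b q n * pfac A a b q (S n)) *
    (qpoch (q / A) q n / qpoch q q n) =
  / ((1 - q) * ((a + b) * A - b)) *
    ((qbin_term A (b / (a + b)) q (S n) / pfac A a b q (S n) -
      qbin_term A (b / (a + b)) q n / pfac A a b q n) +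
     - / ((a + b) * A * (1 - q)) *
       phi21_term (q / A) q (q ^ 2) q (b / (a + b)) n).
Proof.
pose proof (qpoch_q_neq_0 q hq1 n) as Ht.
pose proof (one_sub_pow_neq_0 q hq1 n) as Hn.
pose proof (one_sub_q_neq_0 q hq1) as H1.
rewrite (phi21_term_q_q2 q hq1); unfold qbin_term.
change (qpoch (q / A) q (S n)) with (qpoch (q / A) q n * (1 - q / A * q ^ n)).
change (qpoch q q (S n)) with (qpoch q q n * (1 - q ^ S n)).
replace (b * q / (a + b)) with (b / (a + b) * q) by (field; exact hab).
rewrite Cpow_mult_l, (Cpow_S (b / (a + b))).
generalize dependent (qpoch q q n); intros t Ht.
generalize (qpoch (q / A) q n) ((b / (a + b)) ^ n); intros t' X.
unfold pfac in *; rewrite !Cpow_S in *.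
generalize dependent (q ^ n); intros Q **.
field; repeat split; assumption.
Qed.

(** Up to the factor [(1 - q^(n+1)) / ((1 - q) pfac n)], whose modulus has a
    finite limit when [a A] is nonzero, this is the general term of the
    convergent 2-phi-1 series. *)
Lemma is_lim_seq_Cmod_qbin_pfac (A a b q x : C) (hq1 : (Cmod q < 1)%R)
    (hx : (Cmod x < 1)%R) (hA : A <> 0) (ha : a <> 0)
    (hp : forall n, pfac A a b q n <> 0) :
  is_lim_seq (fun n => Cmod (qbin_term A x q n / pfac A a b q n)) 0.
Proof.
pose proof (one_sub_q_neq_0 q hq1) as H1.
pose proof (proj1 (Cmod_gt_0 _) H1) as H1'.
assert (HaA : (0 < Cmod (- (a * A)))%R).
{ rewrite Cmod_opp; apply Cmod_gt_0, Cmult_neq_0; assumption. }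
apply is_lim_seq_ext with (u := fun n =>
  (Cmod (phi21_term (q / A) q (q ^ 2) q x n) *
     (Cmod (1 + - q * q ^ n) / Cmod (1 - q)) / Cmod (pfac A a b q n))%R).
{ intros n; pose proof (one_sub_pow_neq_0 q hq1 n) as Hn.
  rewrite <- Cmod_div by exact H1.
  rewrite <- Cmod_mult, <- Cmod_div by apply hp.
  f_equal; f_equal.
  rewrite (phi21_term_q_q2 q hq1); fold (qbin_term A x q n).
  unfold qbin_term; rewrite Cpow_S in *; field; repeat split; auto.
  apply (qpoch_q_neq_0 q hq1). }
replace (Finite 0) with
  (Finite (0 * (Cmod 1 / Cmod (1 - q)) / Cmod (- (a * A))))
  by (f_equal; field; split; lra).
apply is_lim_seq_div'.
- apply is_lim_seq_mult'.
  + apply ex_series_lim_0, ex_series_Cmod_phi21_q_q2; assumption.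
  + apply is_lim_seq_div'; [|apply is_lim_seq_const|lra].
    now apply is_lim_seq_Cmod_add_geom.
- now apply is_lim_seq_Cmod_add_geom.
- lra.
Qed.

Lemma p_den_pfac (q L a b : C) (n : nat) :
  Cexp L = q ->
  p_den L q a b n = pfac (qpow L a) a b q n * pfac (qpow L a) a b q (S n).
Proof.
intros hL; unfold p_den, pfac.
rewrite !qpow_add, qpow_INR, qpow_1, hL, Nat.add_1_r, Cpow_S; ring.
Qed.

Theorem theorem2 :
  forall (q L a b : C)
    (hq0 : q <> 0) (hq1 : (Cmod q < 1)%R) (hL : Cexp L = q)
    (hab : a + b <> 0) (hx : (Cmod (b / (a + b)) < 1)%R)
    (hb : b <> 0) (hqa : qpow L a <> 1)
    (hden : a * qpow L a - b * (1 - qpow L a) <> 0)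
    (hp : forall n : nat, p_den L q a b n <> 0),
  let u := fun n : nat =>
    (b * q / (a + b)) ^ n / p_den L q a b n *
    (qpoch (qpow L (1 - a)) q n / qpoch q q n) in
  ex_Cseries u /\
  ex_Cseries (phi21_term (qpow L (1 - a)) q (q ^ 2) q (b / (a + b))) /\
  (a + b) * (1 - q) ^ 2 * qpow L (2 * a - 1) * CSeries u =
    (a + b) * (1 - q) * qpow L (2 * a - 1) /
      (b * (1 - qpow L a) * (a * qpow L a - b * (1 - qpow L a)))
    - 1 / (q * (a + b - b * qpow L (- a))) *
      phi21 (qpow L (1 - a)) q (q ^ 2) q (b / (a + b)).
Proof.
intros q L a b hq0 hq1 hL hab hx hb hqa hden hp u; unfold phi21.
assert (hA := qpow_neq_0 L a).
assert (E1 : qpow L (1 - a) = q / qpow L a).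
{ unfold Cminus; rewrite qpow_add, qpow_opp, qpow_1, hL; reflexivity. }
assert (E2 : qpow L (2 * a - 1) = qpow L a ^ 2 / q).
{ replace (2 * a - 1) with (a + a + - (1)) by ring.
  rewrite !qpow_add, qpow_opp, qpow_1, hL; field; exact hq0. }
subst u; rewrite E1, E2, qpow_opp.
assert (Hpden := fun n => p_den_pfac q L a b n hL).
assert (hp' : forall n, pfac (qpow L a) a b q n <> 0).
{ intros n Hn; apply (hp n); rewrite Hpden.
  rewrite Hn; ring. }
generalize dependent (qpow L a); intros A **.
assert (hD : (a + b) * A - b <> 0).
{ replace ((a + b) * A - b) with (a * A - b * (1 - A)) by ring; exact hden. }
assert (h1A : 1 - A <> 0).
{ intros H; apply hqa; replace A with (1 - (1 - A)) by ring; rewrite H; ring. }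
(* for [a = 0] the argument [b / (a + b)] would be [1] *)
assert (ha : a <> 0).
{ intros ->; replace (b / (0 + b)) with (RtoC 1) in hx.
  - rewrite Cmod_1 in hx; lra.
  - field; rewrite Cplus_0_l in hab; exact hab. }
set (phi := phi21_term (q / A) q (q ^ 2) q (b / (a + b))).
assert (Hphi : ex_Cseries phi)
  by now apply ex_Cseries_Cmod, ex_series_Cmod_phi21_q_q2.
set (v := fun n => qbin_term A (b / (a + b)) q n / pfac A a b q n).
destruct Hphi as [l Hl].
assert (Hu : @is_series C_AbsRing C_NormedModule
  (fun n => (b * q / (a + b)) ^ n / p_den L q a b n *
            (qpoch (q / A) q n / qpoch q q n))
  (/ ((1 - q) * ((a + b) * A - b)) *
     (- v O + - / ((a + b) * A * (1 - q)) * l))).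
{ apply (@is_series_ext C_AbsRing C_NormedModule) with
    (a := fun n => / ((1 - q) * ((a + b) * A - b)) *
      ((v (S n) - v n) + - / ((a + b) * A * (1 - q)) * phi n)).
  { intros n; rewrite Hpden; symmetry; apply summand_by_parts; auto. }
  apply (@is_series_scal C_AbsRing C_NormedModule).
  apply (@is_series_plus C_AbsRing C_NormedModule).
  - apply is_series_telescope, is_lim_seq_Cmod_qbin_pfac; assumption.
  - apply (@is_series_scal C_AbsRing C_NormedModule), Hl. }
split; [now eexists; exact Hu|]; split; [now exists l|].
rewrite (is_series_CSeries _ _ Hu), (is_series_CSeries _ _ Hl).
pose proof (one_sub_q_neq_0 q hq1) as H1.
unfold v, qbin_term, pfac; simpl.
assert (Hg0 : - (a * A) + ((a + b) * A - b) * 1 = - (b * (1 - A))) by ring.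
rewrite Hg0.
field; repeat split; auto.
Qed.
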